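(* Let $K$ be the attractor of the system $\mathcal{S}=\{S_0,S_1,S_2,S_3\}$ corresponding to admissible parameters $p_1,p_2,p_3,B_1,B_2,B_3$. Let $O$ be the fixed point of $S_0$, let $\gamma_1\subset K$ be the arc in $K$ with endpoints $O$ and $A_1$, and let $s=\dim_H(\gamma_1)$. Then for any $x,y\in K$ with $x\neq y$, the arc $\gamma_{xy}\subset K$ with endpoints $x$ and $y$ satisfies $\dim_H(\gamma_{xy})=s$.
   Context: Identify $\mathbb{R}^2$ with $\mathbb{C}$. Let $\Delta$ be the (closed, filled) triangle with vertices $A_1=0$, $A_2=1$, $A_3=e^{i\pi/3}=(1/2,\sqrt3/2)$. For positive numbers $p_1,p_2,p_3$ with $p_1+p_2+p_3<1$ put $S_1(z)=p_1z$, $S_2(z)=p_2z-p_2+1$, $S_3(z)=p_3z-p_3e^{i\pi/3}+e^{i\pi/3}$ (contracting similarities fixing $A_1,A_2,A_3$ respectively), and write $S_{ij}=S_i\circ S_j$. Let $K'$ be the attractor of $\{S_1,S_2,S_3\}$, i.e. the unique nonempty compact set with $K'=S_1(K')\cup S_2(K')\cup S_3(K')$. The parameters $p_1,p_2,p_3,B_1,B_2,B_3$ are called admissible if $p_1,p_2,p_3>0$, $p_1+p_2+p_3<1$, and $B_1,B_2,B_3$ are the vertices of an equilateral triangle with $$B_1\in K'\cap S_{12}([A_2A_3]),\quad B_2\in K'\cap S_{23}([A_1A_3]),\quad B_3\in K'\cap S_{31}([A_1A_2]),$$ where $[A_iA_j]$ denotes the closed side of $\Delta$ joining $A_i$ and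 $A_j$. For admissible parameters, $S_0$ is the similarity of the plane with $S_0(A_k)=B_k$, $k=1,2,3$. The attractor $K$ of $\mathcal{S}$ is the unique nonempty compact set with $K=\bigcup_{i=0}^3S_i(K)$. It is a dendrite, so any two distinct points of $K$ are joined by a unique arc in $K$. $\dim_H$ denotes Hausdorff dimension. *)

(* Defs.v *)
From HB Require Import structures.
From mathcomp Require Import all_boot all_order all_algebra.
From mathcomp Require Import all_classical all_reals all_analysis.

Set Implicit Arguments.
Unset Strict Implicit.
Unset Printing Implicit Defensive.

Import Order.TTheory GRing.Theory Num.Theory numFieldNormedType.Exports.

Local Open Scope classical_set_scope.
Local Open Scope ring_scope.

(* C is identified with R * R.  The library norm on R * R is the max norm: it
   yields the usual topology, used below for compactness and continuity, but
   not the Euclidean distance, which is edist. *)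
Notation plane R := (Real.sort R * Real.sort R)%type.

Definition edist (R : realType) (x y : plane R) : R :=
  Num.sqrt ((x.1 - y.1) ^+ 2 + (x.2 - y.2) ^+ 2).

Definition segment (R : realType) (a b : plane R) : set (plane R) :=
  [set (1 - t) *: a + t *: b | t in `[0, 1]].

Definition similarity (R : realType) (f : plane R -> plane R) : Prop :=
  exists2 r : R, 0 < r & forall x y, edist (f x) (f y) = r * edist x y.

Definition equilateral (R : realType) (a b c : plane R) : Prop :=
  [/\ a <> b, edist a b = edist b c & edist b c = edist c a].

(* The existence and uniqueness of such a K, for contractions S i, is
   Hutchinson's theorem. *)
Definition is_attractor (R : realType) (n : nat)
    (S : n.-tuple (plane R -> plane R)) (K : set (plane R)) : Prop :=
  [/\ K !=set0, compact K & K = \bigcup_(i : 'I_n) (tnth S i @` K)].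

Definition A1 (R : realType) : plane R := (0, 0).
Definition A2 (R : realType) : plane R := (1, 0).
(* exp(i pi / 3) *)
Definition A3 (R : realType) : plane R := (2^-1, Num.sqrt 3 / 2).

Definition S1 (R : realType) (p1 : R) (z : plane R) : plane R := p1 *: z.
Definition S2 (R : realType) (p2 : R) (z : plane R) : plane R :=
  p2 *: z - p2 *: A2 R + A2 R.
Definition S3 (R : realType) (p3 : R) (z : plane R) : plane R :=
  p3 *: z - p3 *: A3 R + A3 R.

Definition admissible (R : realType) (p1 p2 p3 : R) (B1 B2 B3 : plane R)
    : Prop :=
  [/\ [/\ 0 < p1, 0 < p2 & 0 < p3],
      p1 + p2 + p3 < 1,
      equilateral B1 B2 B3
    & exists2 K' : set (plane R),
        is_attractor [tuple S1 p1; S2 p2; S3 p3] K'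
      & [/\ (K' `&` ((S1 p1 \o S2 p2) @` segment (A2 R) (A3 R))) B1,
            (K' `&` ((S2 p2 \o S3 p3) @` segment (A1 R) (A3 R))) B2
          & (K' `&` ((S3 p3 \o S1 p1) @` segment (A1 R) (A2 R))) B3]].

(* A continuous injection of the compact [0, 1] into the Hausdorff plane is a
   homeomorphism onto its image. *)
Definition is_arc (R : realType) (x y : plane R) (gamma : set (plane R))
    : Prop :=
  exists f : R -> plane R,
    [/\ {within `[0, 1], continuous f}, set_inj `[0, 1] f,
        f @` `[0, 1] = gamma, f 0 = x & f 1 = y].

(* The outer maximum gives the empty set diameter 0 rather than -oo. *)
Definition diam (R : realType) (U : set (plane R)) : \bar R :=
  maxe 0%E (ereal_sup [set (edist z.1 z.2)%:E | z in U `*` U]).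

(* The case split matters only for s = 0: with it, the 0-dimensional measure
   counts points. *)
Definition diam_pow (R : realType) (s : R) (U : set (plane R)) : \bar R :=
  if U == set0 then 0%E else poweR (diam U) s.

Definition hausdorff_content (R : realType) (s delta : R) (E : set (plane R))
    : \bar R :=
  ereal_inf [set (\sum_(0 <= i <oo) diam_pow s (U i))%E | U in
    [set U : nat -> set (plane R) |
      E `<=` \bigcup_i U i /\ forall i, (diam (U i) <= delta%:E)%E]].

Definition hausdorff_measure (R : realType) (s : R) (E : set (plane R))
    : \bar R :=
  ereal_sup [set hausdorff_content s delta E | delta in
    [set delta : R | 0 < delta]].

Definition hausdorff_dim (R : realType) (E : set (plane R)) : \bar R :=
  ereal_inf [set s%:E | s in
    [set s : R | 0 <= s /\ hausdorff_measure s E = 0%E]].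

(* Main.v *)
(* Work with subcontinua of K (closed connected subsets) instead of arcs.  The
   four pieces S_i(K) meet only at the joints B_a = S_0(A_a), so a subcontinuum
   meeting two pieces contains the joint between them, and its preimage under
   each S_i is again a subcontinuum; all arguments descend through the pieces
   this way.  First, an arc of K from x to y lies in every subcontinuum
   containing x and y.  Second, since B_1 lies in S_12(K), B_2 in S_23(K) and
   B_3 in S_31(K), a subcontinuum containing O and A_a contains a similar copy
   of the pair (O, A_(a+1)), hence of every pair (O, A_b); so does a
   subcontinuum with two distinct points, which gives the lower bound on the
   dimension.  Third, gluing pullbacks of gamma_1 yields a subcontinuum T
   containing O and all S_i(O), of dimension at most that of gamma_1; any arc of
   K is covered by its ends and the countably many images of T under words in
   the S_i, which gives the upper bound. *)
Require Import Defs.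
From HB Require Import structures.
From mathcomp Require Import all_boot all_order all_algebra.
From mathcomp Require Import all_classical all_reals all_analysis.
From mathcomp Require Import ring lra.
Import Order.TTheory GRing.Theory Num.Theory numFieldNormedType.Exports.
(* Again, since MathComp-Analysis has another [edist]. *)
Import Defs.
Local Open Scope classical_set_scope.
Local Open Scope ring_scope.

Set Implicit Arguments.
Unset Strict Implicit.

(** * Connected sets and the Euclidean distance *)

Section ConnectedPieces.
Context {T : topologicalType}.
Implicit Types (C F G : set T) (b : T).

(** If [b] were not in [C], the closed sets [F] and [G] would be disjoint within [C], so [C] meets
    [F] in a nonempty clopen part, which is all of [C]; but [C] also meets [G]. *)
Lemma connected_cut C F G b :
  connected C -> closed F -> closed G -> C `<=` F `|` G ->
  F `&` G `<=` [set b] -> C `&` F !=set0 -> C `&` G !=set0 -> C b.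
Proof.
move=> cC clF clG CFG FG [x [Cx Fx]] [y [Cy Gy]]; apply: contrapT => nCb.
have nFG z : C z -> F z -> ~ G z.
  by move=> Cz Fz Gz; have /= zb := FG z (conj Fz Gz); rewrite zb in Cz.
have CF : C `&` F = C.
  apply: cC; first by exists x.
  - exists (~` G); first exact: closed_openC.
    apply/seteqP; split=> z [Cz Fz]; split=> //; first exact: nFG.
    by case: (CFG z Cz).
  - by exists F.
have [_ Fy] : (C `&` F) y by rewrite CF.
exact: nFG Cy Fy Gy.
Qed.

(** A relatively clopen part of the trace that misses [b] is disjoint from [G], hence clopen in [C]
    too, and equals [C] if nonempty. Of a clopen part and its complement in the trace, at least one
    misses [b]. *)
Lemma connected_trace C F G b :
  connected C -> closed F -> closed G -> C `<=` F `|` G ->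
  F `&` G `<=` [set b] -> connected (C `&` F).
Proof.
move=> cC clF clG CFG FG.
have avoid B : B !=set0 -> ~ B b -> (exists2 U, open U & B = (C `&` F) `&` U) ->
    (exists2 V, closed V & B = (C `&` F) `&` V) -> B = C.
  move=> B0 nBb [U oU BU] [V cV BV]; apply: cC => //.
    exists (U `&` ~` G); first by apply: openI => //; exact: closed_openC.
    apply/seteqP; split=> z.
      move=> Bz; have := Bz; rewrite BU => -[[Cz Fz] Uz]; split=> //;
        split=> // Gz.
      by have /= zb := FG z (conj Fz Gz); rewrite -zb in nBb.
    by move=> [Cz [Uz nGz]]; rewrite BU; case: (CFG z Cz).
  by exists (F `&` V); [exact: closedI|rewrite setIA].
move=> B B0 oB cB; have [Bb|nBb] := pselect (B b); last first.
  have BC := avoid B B0 nBb oB cB; case: oB => U _ BU.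
  by apply/seteqP; split=> [z|z [Cz Fz]]; [rewrite BU => -[]|rewrite BC].
apply/seteqP; split=> [z|z CFz]; first by case: oB => U _ -> [].
apply: contrapT => nBz; case: oB cB => U oU BU [V cV BV].
have CB : (C `&` F) `\` B = C.
  apply: avoid; first by exists z.
  - by move=> [_].
  - exists (~` V); first exact: closed_openC.
    rewrite BV; apply/seteqP; split=> t [? nVt]; split=> //.
      by move=> Vt; apply: nVt.
    by case.
  - exists (~` U); first exact: open_closedC.
    rewrite BU; apply/seteqP; split=> t [? nVt]; split=> //.
      by move=> Vt; apply: nVt.
    by case.
have : C b by have := Bb; rewrite BU => -[[]].
by rewrite -CB => -[].
Qed.

(** On the compact set [E] the injection [f] is a closed map, so it carries a clopen part of [E] to
    a clopen part of the image. *)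
Lemma connected_preimage {U : topologicalType} (E : set U) (f : U -> T) :
  hausdorff_space T -> hausdorff_space U -> continuous f -> injective f ->
  compact E -> connected (f @` E) -> connected E.
Proof.
move=> hT hU cf inj_f cE cfE B [x Bx] [V oV BV] [W cW BW].
have clE : closed E by exact: compact_closed.
have img (D : set U) : closed D -> closed (f @` (E `&` D)).
  move=> cD; apply: compact_closed => //; apply: continuous_compact.
    exact: continuous_subspaceT.
  exact: compact_closedI.
have fB : f @` B = f @` E.
  apply: cfE; first by exists (f x); exists x.
    exists (~` (f @` (E `&` ~` V))).
      by apply: closed_openC; apply: img; exact: open_closedC.
    apply/seteqP; split=> [_ [z + <-]|_ [[z Ez <-] nz]].
      rewrite BV => -[Ez Vz]; split; first by exists z.
      by move=> [t [Et nVt] /inj_f tz]; rewrite tz in nVt.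
    exists z => //; rewrite BV; split=> //; apply: contrapT => nVz; apply: nz.
    by exists z.
  exists (f @` (E `&` W)); first exact: img.
  rewrite BW; apply/seteqP; split=> [_ [z [Ez Wz] <-]|_ [_ [z EWz <-]]].
    by split; exists z.
  by exists z.
apply/seteqP; split=> [z|z Ez]; first by rewrite BW => -[].
have : (f @` B) (f z) by rewrite fB; exists z.
by move=> [t Bt /inj_f <-].
Qed.

End ConnectedPieces.

Section Edist.
Context {R : realType}.
Implicit Types (x y z : plane R) (E F C D P Q : set (plane R)).

Lemma edist_ge0 x y : 0 <= edist x y.
Proof. exact: sqrtr_ge0. Qed.

Lemma edist_sqr x y : edist x y ^+ 2 = (x.1 - y.1) ^+ 2 + (x.2 - y.2) ^+ 2.
Proof. by rewrite /edist sqr_sqrtr// addr_ge0// sqr_ge0. Qed.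

Lemma edistxx x : edist x x = 0.
Proof. by rewrite /edist !subrr expr0n addr0 sqrtr0. Qed.

Lemma edist_eq0 x y : edist x y = 0 -> x = y.
Proof.
move=> /(congr1 (fun t => t ^+ 2)); rewrite edist_sqr expr0n/= => /eqP.
rewrite paddr_eq0 ?sqr_ge0// !sqrf_eq0 !subr_eq0 => /andP[/eqP + /eqP].
by case: x y => ? ? [? ?] /= -> ->.
Qed.

Lemma edist_gt0 x y : x <> y -> 0 < edist x y.
Proof.
move=> xy; rewrite lt_neqAle edist_ge0 andbT eq_sym.
by apply/eqP => /edist_eq0.
Qed.

Lemma norm_le_edist x y : `|x - y| <= edist x y.
Proof.
rewrite prod_normE ge_max; apply/andP; split;
  rewrite -(@ler_pXn2r _ 2%N)// ?nnegrE ?edist_ge0// edist_sqr;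
  by rewrite real_normK ?num_real//= ?lerDl ?lerDr sqr_ge0.
Qed.

Lemma edist_le_norm x y : edist x y <= 2 * `|x - y|.
Proof.
rewrite -(@ler_pXn2r _ 2%N)// ?nnegrE ?edist_ge0 ?mulr_ge0// edist_sqr exprMn.
have h1 : (x.1 - y.1) ^+ 2 <= `|x - y| ^+ 2.
  rewrite -[leLHS]real_normK ?num_real// ler_pXn2r ?nnegrE//.
  by rewrite [leRHS]prod_normE le_max lexx.
have h2 : (x.2 - y.2) ^+ 2 <= `|x - y| ^+ 2.
  rewrite -[leLHS]real_normK ?num_real// ler_pXn2r ?nnegrE//.
  by rewrite [leRHS]prod_normE le_max lexx orbT.
have := sqr_ge0 `|x - y|; lra.
Qed.

(** The max norm and the Euclidean distance bound each other up to a factor 2, so Euclidean balls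
    generate the topology in use. *)
Lemma nbhs_edist x (U : set (plane R)) :
  nbhs x U <-> exists2 e, 0 < e & forall y, edist x y < e -> U y.
Proof.
split=> [/nbhs_normP[e /= e0 eU]|[e e0 eU]].
  by exists e => // y xy; apply: eU => /=;
    apply: le_lt_trans (norm_le_edist _ _) xy.
apply: (iffRL (@nbhs_normP _ (plane R) x U)); exists (e / 2) => /=;
  first by rewrite divr_gt0.
by move=> y /= xy; apply: eU; apply: le_lt_trans (edist_le_norm _ _) _; lra.
Qed.

Lemma closed_edist C x : closed C ->
  (forall e, 0 < e -> exists2 y, C y & edist x y < e) -> C x.
Proof.
move=> cC h; apply: cC => U /nbhs_edist[e e0 eU].
by have [y Cy xy] := h e e0; exists y; split=> //; exact: eU.
Qed.

Lemma plane_hausdorff : hausdorff_space (plane R).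
Proof. exact: (@norm_hausdorff R (plane R)). Qed.

Lemma compact_edist_gap P Q : compact P -> compact Q -> P `&` Q = set0 ->
  exists2 e, 0 < e & forall x y, P x -> Q y -> e <= edist x y.
Proof.
move=> cP cQ PQ; have [[[a b] [Pa Qb]]|PQ0] := pselect (P `*` Q !=set0);
  last first.
  by exists 1 => // x y Px Qy; exfalso; apply: PQ0; exists (x, y).
have [//|||[u v]] := @compact_EVT_min _ R (fun z : plane R * plane R => `|z.1 -
  z.2|)
    (P `*` Q).
- by exists (a, b).
- exact: compact_setX.
- apply: continuous_subspaceT => z; apply: cvg_norm; apply: cvgB.
    exact: cvg_fst.
  exact: cvg_snd.
rewrite inE => -[/= Pu Qv] min_uv; exists `|u - v|.
  rewrite normr_gt0 subr_eq0; apply/eqP => uv; rewrite uv in Pu.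
  by have : (P `&` Q) v by []; rewrite PQ.
move=> x y Px Qy; apply: le_trans (norm_le_edist x y).
by apply: (min_uv (x, y)); rewrite inE.
Qed.

Lemma compact_edist_bound C : compact C ->
  exists2 d, 0 < d & forall x y, C x -> C y -> edist x y <= d.
Proof.
move=> /(@compact_bounded _ (plane R)) -[M [_ hM]].
have {}hM x : C x -> `|x| <= `|M| + 1.
  by apply: hM; rewrite ltr_pwDr// ler_norm.
exists (2 * (`|M| + 1 + (`|M| + 1))) => [|x y Cx Cy].
  by rewrite mulr_gt0// addr_gt0// ltr_wpDl.
apply: le_trans (edist_le_norm _ _) _; rewrite ler_pM2l//.
by apply: le_trans (ler_normB _ _) _; rewrite lerD ?hM.
Qed.

Section Similarity.
Variables (q : R) (f : plane R -> plane R).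
Hypothesis q0 : 0 < q.
Hypothesis fq : forall x y, edist (f x) (f y) = q * edist x y.

Lemma sim_inj : injective f.
Proof.
move=> x y xy; apply: edist_eq0; apply: (mulfI (lt0r_neq0 q0)).
by rewrite -fq xy edistxx mulr0.
Qed.

Lemma sim_continuous : continuous f.
Proof.
move=> x U /nbhs_edist[e e0 eU]; apply/nbhs_edist; exists (e / q).
  by rewrite divr_gt0.
by move=> y xy; apply: eU; rewrite fq mulrC -ltr_pdivlMr.
Qed.

End Similarity.
End Edist.

(** * Hausdorff null sets *)

Section HausdorffNull.
Context {R : realType}.
Implicit Types (x y z : plane R) (D E F : set (plane R)).
Local Open Scope ereal_scope.

Lemma diam_ge0 D : 0 <= diam D.
Proof. by rewrite /diam le_max lexx. Qed.

Lemma edist_le_diam D x y : D x -> D y -> (edist x y)%:E <= diam D.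
Proof.
by move=> Dx Dy; rewrite /diam le_max; apply/orP; right;
  apply: ereal_sup_ubound; exists (x, y).
Qed.

Lemma diam_le D (c : \bar R) :
  0 <= c -> (forall x y, D x -> D y -> (edist x y)%:E <= c) -> diam D <= c.
Proof.
move=> c0 Dc; rewrite /diam ge_max c0/=;
  apply: ge_ereal_sup => _ [[x y] [Dx Dy] <-].
exact: Dc.
Qed.

Lemma diam0 : diam (@set0 (plane R)) = 0.
Proof. by apply/eqP; rewrite eq_le diam_ge0 andbT; apply: diam_le. Qed.

Lemma diam_pow_ge0 (t : R) D : 0 <= diam_pow t D.
Proof. by rewrite /diam_pow; case: ifP => // _; exact: poweR_ge0. Qed.

Lemma diam_pow0 (t : R) : diam_pow t (@set0 (plane R)) = 0.
Proof. by rewrite /diam_pow eqxx. Qed.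

Definition fine_cover (t delta eps : R) E (U : nat -> set (plane R)) :=
  [/\ E `<=` \bigcup_i U i, forall i, diam (U i) <= delta%:E
    & \sum_(0 <= i <oo) diam_pow t (U i) <= eps%:E].

(** The dimension is an infimum of exponents of measure zero, so only null sets matter; this form
    replaces the supremum and infimum by explicit covers. *)
Lemma hausdorff_measure_eq0 (t : R) E : hausdorff_measure t E = 0 <->
  forall delta eps : R, (0 < delta)%R -> (0 < eps)%R ->
    exists U, fine_cover t delta eps E U.
Proof.
split=> [E0 delta eps d0 e0|h].
  have : hausdorff_content t delta E < eps%:E.
    apply: (@le_lt_trans _ _ 0); last by rewrite lte_fin.
    by rewrite -E0; apply: ereal_sup_ubound; exists delta.
  by move=> /ereal_inf_lt[_ [U [EU Ud] <-] /ltW Ue]; exists U.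
apply/eqP; rewrite eq_le; apply/andP; split.
  apply: ge_ereal_sup => _ [delta /= d0 <-]; apply/lee_addgt0Pr => e e0.
  rewrite add0e; have [U [EU Ud Ue]] := h delta e d0 e0.
  apply: le_trans Ue; apply: ereal_inf_lbound; exists U => //; split.
apply: ereal_sup_ge; exists (hausdorff_content t 1 E);
  first by exists 1%R => //=.
by apply: le_ereal_inf_tmp => _ [U _ <-]; apply: nneseries_ge0 => *;
  exact: diam_pow_ge0.
Qed.

(** At exponent 0 each nonempty member of a cover contributes 1, so no cover of a nonempty set has
    total at most 1/2. *)
Lemma hausdorff_measure0_neq0 E : E !=set0 -> hausdorff_measure 0 E != 0.
Proof.
move=> [x Ex]; apply/eqP => /hausdorff_measure_eq0/(_ 1 2^-1)%R[]//.
move=> U [/(_ x Ex)[i _ Uix] _]; apply/negP; rewrite -ltNge.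
apply: (@lt_le_trans _ _ 1); first by rewrite lte_fin; lra.
apply: (@le_trans _ _ (\sum_(0 <= j < i.+1) diam_pow 0 (U j))).
  have Ui1 : diam_pow 0 (U i) = 1.
    by rewrite /diam_pow ifF ?poweRe0//; apply/negP => /eqP Ui0;
      rewrite Ui0 in Uix.
  by rewrite big_nat_recr//= Ui1 leeDr// sume_ge0// => *; exact: diam_pow_ge0.
by apply: nneseries_lim_ge => *; exact: diam_pow_ge0.
Qed.

Lemma hausdorff_dim_le E F :
  (forall t, (0 <= t)%R -> hausdorff_measure t E = 0 -> hausdorff_measure t F =
    0) ->
  hausdorff_dim F <= hausdorff_dim E.
Proof.
by move=> EF; apply: ereal_inf_le_tmp => _ [t [t0 Et] <-]; exists t => //;
  split=> //; exact: EF.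
Qed.

(** The inverse of [g] is [L]-Lipschitz, so pulling a cover of [F] back along [g] multiplies
    diameters by at most [L] and their powers by at most [L ^ t]. Inclusions, images and pullbacks
    under similarities are all instances. *)
Lemma hausdorff_null_expand (t L : R) E F (g : plane R -> plane R) :
  (0 <= t)%R -> (0 < L)%R -> (forall x, E x -> F (g x)) ->
  (forall x y, E x -> E y -> (edist x y <= L * edist (g x) (g y))%R) ->
  hausdorff_measure t F = 0 -> hausdorff_measure t E = 0.
Proof.
move=> t0 L0 gEF gL /hausdorff_measure_eq0 F0.
apply/hausdorff_measure_eq0 => delta eps d0 e0.
have [||U [FU Ud Ue]] := F0 (delta / L)%R (eps / (L `^ t))%R.
- by rewrite divr_gt0.
- by rewrite divr_gt0// powR_gt0.
pose V i := E `&` g @^-1` U i.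
have dV i : diam (V i) <= L%:E * diam (U i).
  apply: diam_le; first by rewrite mule_ge0 ?diam_ge0// lee_fin ltW.
  move=> x y [Ex Ugx] [Ey Ugy]; apply: (@le_trans _ _ (L * edist (g x) (g
    y))%:E).
    by rewrite lee_fin gL.
  by rewrite EFinM lee_pmul2l ?lte_fin// edist_le_diam.
exists V; split.
- by move=> x Ex; have [i _ Ui] := FU _ (gEF x Ex); exists i.
- move=> i; apply: le_trans (dV i) _.
  by rewrite muleC -lee_pdivlMr// -EFinM Ud.
- apply: (@le_trans _ _ (\sum_(0 <= i <oo) ((L `^ t)%:E * diam_pow t (U i)))).
    apply: lee_nneseries => [i _ _|i _]; first exact: diam_pow_ge0.
    have [->|/set0P[x [Ex Ux]]] := eqVneq (V i) set0.
      by rewrite diam_pow0 mule_ge0 ?diam_pow_ge0// lee_fin powR_ge0.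
    rewrite /diam_pow !ifF; last 2 first.
    + by apply/negP => /eqP Ui0; rewrite Ui0 in Ux.
    + by apply/negP => /eqP Vi0; have : V i x by []; rewrite Vi0.
    rewrite -poweR_EFin -poweRM ?lee_fin ?diam_ge0//; last exact: ltW.
    apply: gt0_ler_poweR => //; rewrite ?in_itv/= ?leey ?andbT ?diam_ge0//.
    by rewrite mule_ge0 ?diam_ge0// lee_fin ltW.
  rewrite nneseriesZl; last by move=> i _; exact: diam_pow_ge0.
  by rewrite muleC -lee_pdivlMr ?powR_gt0// -EFinM.
Qed.

Lemma hausdorff_null_sub (t : R) E F : (0 <= t)%R -> E `<=` F ->
  hausdorff_measure t F = 0 -> hausdorff_measure t E = 0.
Proof.
move=> t0 EF; apply: (@hausdorff_null_expand t 1 E F id) => //.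
by move=> x y _ _; rewrite mul1r.
Qed.

Lemma hausdorff_null_image (t q : R) E (f : plane R -> plane R) :
  (0 <= t)%R -> (0 < q)%R ->
  (forall x y, edist (f x) (f y) = q * edist x y)%R ->
  hausdorff_measure t E = 0 -> hausdorff_measure t (f @` E) = 0.
Proof.
move=> t0 q0 fq; have /choice[g gP] : forall y, exists x, (f @` E) y -> E x /\
  f x = y.
  move=> y; have [[x Ex fx]|nEy] := pselect ((f @` E) y); first by exists x.
  by exists y.
apply: (@hausdorff_null_expand t q _ _ g) => //; first by move=> y /gP[].
by move=> x y /gP[_ fx] /gP[_ fy]; rewrite -fq fx fy.
Qed.

Lemma hausdorff_null_bigcup_nat (t : R) (E : nat -> set (plane R)) :
  (forall n, hausdorff_measure t (E n) = 0) ->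
  hausdorff_measure t (\bigcup_n E n) = 0.
Proof.
move=> E0; apply/hausdorff_measure_eq0 => delta eps d0 e0.
have /choice[U UP] : forall n, exists U,
    fine_cover t delta (eps / (2 ^ n.+1)%:R) (E n) U.
  move=> n; have /hausdorff_measure_eq0 := E0 n; apply => //.
  by rewrite divr_gt0// ltr0n expn_gt0.
(* The covers, of total at most [eps / 2 ^ n.+1] each, are merged into one sequence along a
   bijection onto pairs of indices. *)
have /ppcard_eqP[f] : ([set: nat] #= [set: nat * nat])%card.
  by rewrite card_eq_sym; exact: card_nat2.
exists (fun n => U (f n).1 (f n).2); split.
- move=> x [n _ Enx]; have [/(_ _ Enx)[k _ Ukx] _ _] := UP n.
  have [m _ fm] := @surj _ _ _ _ f (n, k) I.
  by exists m => //=; rewrite fm.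
- by move=> i; have [_ + _] := UP (f i).1; exact.
- rewrite nneseries_esumT; last by move=> i; exact: diam_pow_ge0.
  rewrite -(@reindex_esum R _ _ setT setT f (fun p => diam_pow t (U p.1
    p.2)))//.
  rewrite (_ : [set: nat * nat] = [set: nat] `*`` (fun=> [set: nat]));
    last first.
    by apply/seteqP; split.
  rewrite -(@esum_esum _ _ _ _ _ (fun i j => diam_pow t (U i j))); last first.
    by move=> *; exact: diam_pow_ge0.
  rewrite -nneseries_esumT; last by move=> i; apply: esum_ge0 => *;
    exact: diam_pow_ge0.
  apply: (le_trans _ (epsilon_trick0 xpredT (ltW e0))).
  apply: lee_nneseries => [i _ _|i _].
    by apply: esum_ge0 => *; exact: diam_pow_ge0.
  have [_ _ +] := UP i.
  by rewrite nneseries_esumT// => j; exact: diam_pow_ge0.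
Qed.

Lemma hausdorff_null0 (t : R) : (0 <= t)%R -> hausdorff_measure t set0 = 0.
Proof.
move=> t0; apply/hausdorff_measure_eq0 => delta eps d0 e0; exists (fun=> set0).
split=> //; first by move=> i; rewrite diam0 lee_fin ltW.
by rewrite eseries0 ?lee_fin ?ltW// => i _ _; rewrite diam_pow0.
Qed.

Lemma hausdorff_null1 (t : R) x : (0 < t)%R -> hausdorff_measure t [set x] = 0.
Proof.
move=> t0; apply/hausdorff_measure_eq0 => delta eps d0 e0.
have dx : diam [set x] = 0.
  apply/eqP; rewrite eq_le diam_ge0 andbT; apply: diam_le => // _ _ -> ->.
  by rewrite edistxx.
exists (fun=> [set x]); split.
- by move=> y ->; exists 0%N.
- by move=> i; rewrite dx lee_fin ltW.
- rewrite eseries0 ?lee_fin ?ltW// => i _ _.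
  by rewrite /diam_pow; case: ifP => // _; rewrite dx poweR0r// gt_eqF.
Qed.

Lemma hausdorff_null_bigcup (I : countType) (t : R) (E : I -> set (plane R)) :
  (0 <= t)%R -> (forall i, hausdorff_measure t (E i) = 0) ->
  hausdorff_measure t (\bigcup_i E i) = 0.
Proof.
move=> t0 E0; pose F n := if @unpickle I n is Some i then E i else set0.
apply: (@hausdorff_null_sub _ _ (\bigcup_n F n)) => //.
  by move=> x [i _ Eix]; exists (pickle i) => //; rewrite /F pickleK.
by apply: hausdorff_null_bigcup_nat => n; rewrite /F; case: unpickle => //;
  exact: hausdorff_null0.
Qed.

Lemma hausdorff_null_setU (t : R) E F : (0 <= t)%R ->
  hausdorff_measure t E = 0 -> hausdorff_measure t F = 0 ->
  hausdorff_measure t (E `|` F) = 0.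
Proof.
move=> t0 E0 F0; apply: (@hausdorff_null_sub _ _ (\bigcup_(b : bool) if b then
  E else F)) => //.
  by move=> x [Ex|Fx]; [exists true|exists false].
by apply: hausdorff_null_bigcup => // -[].
Qed.

End HausdorffNull.

(** * Subcontinua of the attractor *)

Section Attraction.
Context {R : realType}.

Lemma expr_small (r c e : R) : 0 <= r < 1 -> 0 < e -> exists n, c * r ^+ n < e.
Proof.
move=> /andP[r0 r1] e0.
have : geometric c r @ \oo --> (0 : R) by apply: cvg_geometric;
  rewrite ger0_norm.
move=> /cvgr0Pnorm_lt/(_ e e0)[n _ /(_ n (leqnn n))] /= h.
by exists n; apply: le_lt_trans h; exact: ler_norm.
Qed.

(** Each point of [X] is the image of a point of [X] under [n] of the maps. The same maps send a
    point of [Y] into [Y], at distance at most [c * r ^ n]; as [Y] is closed, the limit stays in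
    [Y]. *)
Lemma ifs_attract (I : Type) (S : I -> plane R -> plane R) (r : R)
    (X Y : set (plane R)) :
  0 <= r < 1 -> (forall i x y, edist (S i x) (S i y) <= r * edist x y) ->
  compact X -> X `<=` \bigcup_i (S i @` X) ->
  closed Y -> Y !=set0 -> (forall i y, Y y -> Y (S i y)) -> X `<=` Y.
Proof.
move=> r01 Sr cX XS cY [y0 Yy0] SY x Xx.
(* [y0] is adjoined to [X] so that [c] also bounds the distances from [X] to [y0]. *)
have [c c0 Xc] := compact_edist_bound (compactU cX (@compact_set1 _ y0)).
have near n : forall x, X x -> exists2 y, Y y & edist x y <= c * r ^+ n.
  elim: n => [|n IHn] z Xz; first by exists y0 => //; rewrite expr0 mulr1 Xc//;
    [left|right].
  have [i _ [u Xu <-]] := XS z Xz; have [y Yy uy] := IHn u Xu.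
  exists (S i y); first exact: SY.
  apply: le_trans (Sr i u y) _; rewrite exprS mulrCA ler_wpM2l//.
  by case/andP: r01.
apply: closed_edist => // e e0; have [n ne] := expr_small c r01 e0.
by have [y Yy xy] := near n x Xx; exists y => //; exact: le_lt_trans ne.
Qed.

End Attraction.

(* [S None] is the map S_0 of the paper, and [S (Some a)], for a in Z/3, are the
   maps S_1, S_2, S_3 fixing the vertices [A a]. *)
Record tripod_system {R : realType} (S : option 'I_3 -> plane R -> plane R)
    (q : option 'I_3 -> R) (r : R) (K : set (plane R)) (A : 'I_3 -> plane R)
    (O : plane R) : Prop := TripodSystem {
  ts_ratio : forall i, 0 < q i <= r;
  ts_ratio_lt1 : r < 1;
  ts_sim : forall i x y, edist (S i x) (S i y) = q i * edist x y;
  ts_compact : compact K;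
  ts_self : K = \bigcup_i (S i @` K);
  ts_tip : forall a, K (A a);
  ts_tip_fix : forall a, S (Some a) (A a) = A a;
  ts_disjoint : forall a b x y, a != b -> K x -> K y ->
    S (Some a) x <> S (Some b) y;
  ts_touch : forall a x y, K x -> K y -> S None x = S (Some a) y -> x = A a;
  ts_joint : forall a, exists2 z, K z &
    S None (A a) = S (Some a) (S (Some (a + 1)) z);
  ts_center : K O;
  ts_center_fix : S None O = O
}.

Section Tripod.
Context {R : realType} {S : option 'I_3 -> plane R -> plane R}
  {q : option 'I_3 -> R} {r : R} {K : set (plane R)} {A : 'I_3 -> plane R}
  {O : plane R}.
Hypothesis sys : tripod_system S q r K A O.
Implicit Types (x y z : plane R) (C D P Q T : set (plane R)) (a b : 'I_3)
  (i j : option 'I_3) (w : seq (option 'I_3)).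

Let q0 i : 0 < q i. Proof. by have /andP[] := ts_ratio sys i. Qed.
Let qr i : q i <= r. Proof. by have /andP[] := ts_ratio sys i. Qed.
Let r01 : 0 <= r < 1.
Proof. by rewrite (ts_ratio_lt1 sys) andbT (le_trans (ltW (q0 None))) ?qr. Qed.
Let r0 : 0 < r. Proof. exact: lt_le_trans (q0 None) (qr None). Qed.
Let S_cont i : continuous (S i).
Proof. exact: sim_continuous (q0 i) (ts_sim sys i). Qed.
Let S_inj i : injective (S i). Proof. exact: sim_inj (q0 i) (ts_sim sys i). Qed.
Let S_le i x y : edist (S i x) (S i y) <= r * edist x y.
Proof. by rewrite (ts_sim sys) ler_wpM2r ?edist_ge0 ?qr. Qed.
Let K_closed : closed K.
Proof. by apply: compact_closed; [exact: plane_hausdorff|exact: ts_compact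
  sys]. Qed.

Let SK i z : K z -> K (S i z).
Proof. by move=> Kz; rewrite (ts_self sys); exists i => //; exists z. Qed.

Let splitK z : K z -> exists i z', K z' /\ z = S i z'.
Proof. by rewrite {1}(ts_self sys) => -[i _ [z' Kz' <-]]; exists i, z'. Qed.

Let boundK : exists2 d, 0 < d & forall x y, K x -> K y -> edist x y <= d.
Proof. exact: compact_edist_bound (ts_compact sys). Qed.

(** The empty set is allowed, so that the pullback through a piece that [C] misses is still a
    subcontinuum. *)
Definition subcontinuum C := [/\ closed C, connected C & C `<=` K].
Definition pull i C := [set z | K z /\ C (S i z)].
(** The first letter of the word is the outermost map. *)
Definition wmap w z := foldr S z w.
Definition pieces (J : set (option 'I_3)) := \bigcup_(i in J) (S i @` K).

(** This is the vertex B_a, the only point that the corner piece at [a] shares with the other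
    pieces. *)
Let joint a := S None (A a).

Let piece_closed i : closed (S i @` K).
Proof.
apply: compact_closed; first exact: plane_hausdorff.
by apply: continuous_compact; [exact: continuous_subspaceT|exact: ts_compact
  sys].
Qed.

Let pieces_closed J : closed (pieces J).
Proof. by apply: closed_bigcup => //; exact: finite_finset. Qed.

Let pieces_cover i : K `<=` (S i @` K) `|` pieces [set~ i].
Proof.
move=> z /splitK[j [z' [Kz' ->]]]; have [<-|ij] := pselect (j = i);
  first by left; exists z'.
by right; exists j => //; exists z'.
Qed.

Let tip_piece_meet a : (S (Some a) @` K) `&` pieces [set~ Some a] `<=` [set
  joint a].
Proof.
move=> _ [[x Kx <-] [[b|] /= ba [y Ky]]].
  by move=> /(@ts_disjoint _ _ _ _ _ _ _ sys); case=> //; apply/eqP => ab;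
    apply: ba; rewrite ab.
by move=> yx; rewrite /joint -(ts_touch sys Ky Kx yx).
Qed.

Lemma subcontinuum_joint C a j x y : subcontinuum C -> j <> Some a ->
  K x -> K y -> C (S (Some a) x) -> C (S j y) -> C (joint a).
Proof.
move=> [_ cC CK] ja Kx Ky Cx Cy.
apply: (connected_cut cC (@piece_closed (Some a)) (@pieces_closed [set~ Some
  a])).
- by move=> z /CK; exact: pieces_cover.
- exact: tip_piece_meet.
- by exists (S (Some a) x); split=> //; exists x.
- by exists (S j y); split=> //; exists j => //; exists y.
Qed.

(* Cut the three corner pieces off one by one. *)
Let connected_center C : connected C -> C `<=` K -> connected (C `&` (S None @`
  K)).
Proof.
move=> cC CK.
have step (l : seq 'I_3) :
    connected (C `&` [set z | forall a, a \in l -> pieces [set~ Some a] z]).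
  elim: l => [|a l IHl].
    by rewrite (_ : [set z | _] = setT) ?setIT//; apply/seteqP; split.
  rewrite (_ : _ `&` _ = (C `&` [set z | forall a, a \in l -> pieces [set~ Some
    a] z])
     `&` pieces [set~ Some a]); last first.
    apply/seteqP; split=> [z [Cz h]|z [[Cz h] ha]].
      by split; [split=> // b bl|]; apply: h; rewrite inE ?eqxx// bl orbT.
    by split=> // b; rewrite inE => /orP[/eqP->//|]; exact: h.
  apply: (connected_trace IHl (@pieces_closed _) (@piece_closed (Some a))).
    by move=> z [/CK/(pieces_cover (Some a))]; rewrite setUC.
  by rewrite setIC; exact: tip_piece_meet.
have := step (enum 'I_3); congr connected; apply/seteqP; split=> z [Cz].
  move=> h; split=> //; have [[a|] [z' [Kz' zE]]] := splitK (CK _ Cz);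
    last by exists z'.
  have /= -> : [set joint a] z.
    by apply: tip_piece_meet; split; [exists z'|apply: h; rewrite mem_enum].
  by exists (A a) => //; exact: ts_tip sys _.
by move=> Sz; split=> // a _; exists None.
Qed.

(** [S i] maps the pullback homeomorphically onto the trace of [C] on a piece. That trace is
    connected: a corner piece meets the rest in one point, and the central piece is what remains
    after three such cuts. *)
Lemma subcontinuum_pull i C : subcontinuum C -> subcontinuum (pull i C).
Proof.
move=> [clC cC CK]; split; last by move=> z [].
  by apply: closedI => //; apply: preimage_closed => // z _; exact: S_cont.
have cP : compact (pull i C).
  rewrite /pull (_ : mkset _ = K `&` S i @^-1` C)//; apply: compact_closedI.
    exact: ts_compact sys.
  by apply: preimage_closed => // z _; exact: S_cont.
apply: connected_preimage (@S_cont i) (@S_inj i) cP _;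
  [exact: plane_hausdorff|exact: plane_hausdorff|].
rewrite (_ : S i @` _ = C `&` (S i @` K)); last first.
  apply/seteqP; split=> [_ [z [Kz Cz] <-]|t [Ct [z Kz zt]]].
    by split=> //; exists z.
  by rewrite -zt in Ct *; exists z.
case: i => [a|]; last exact: connected_center.
apply: (connected_trace cC (@piece_closed (Some a)) (@pieces_closed [set~ Some
  a])).
  by move=> z /CK; exact: pieces_cover.
exact: tip_piece_meet.
Qed.

Definition pullw w C := [set z | K z /\ C (wmap w z)].

Lemma subcontinuum_pullw w C : subcontinuum C -> subcontinuum (pullw w C).
Proof.
elim: w => [|i w IHw] in C * => sC.
  rewrite (_ : pullw _ _ = C)//; apply/seteqP; split=> [z []//|z Cz].
  by split=> //; case: sC => _ _; exact.
rewrite (_ : pullw _ _ = pullw w (pull i C)); first exact/IHw/subcontinuum_pull.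
apply/seteqP; split=> z [Kz Cz]; split=> //; last by case: Cz.
by split=> //; elim: w {IHw Cz} => //= j w IHw; exact: SK.
Qed.

Lemma subcontinuum_push i C : subcontinuum C -> subcontinuum (S i @` C).
Proof.
move=> [clC cC CK]; split; last by move=> _ [z /CK Kz <-]; exact: SK.
  apply: compact_closed; first exact: plane_hausdorff.
  apply: continuous_compact; first exact: continuous_subspaceT.
  by rewrite -(setIidr CK); apply: compact_closedI => //; exact: ts_compact sys.
by apply: connected_continuous_connected cC _; exact: continuous_subspaceT.
Qed.

Lemma subcontinuumU C D z : C z -> D z ->
  subcontinuum C -> subcontinuum D -> subcontinuum (C `|` D).
Proof.
move=> Cz Dz [clC cC CK] [clD cD DK]; split; first exact: closedU.
  by apply: connectedU => //; exists z.
by rewrite subUset.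
Qed.

(** If [x] and [y] lie in different pieces, the joints between them belong to both [C] and [D].
    Consecutive points of the chain from [x] through these joints to [y] share a piece, and
    somewhere the chain passes from [P] to [Q]. *)
Let split_joints C D P Q x y :
  subcontinuum C -> subcontinuum D -> C `&` D `<=` P `|` Q ->
  C x -> D x -> P x -> C y -> D y -> Q y ->
  exists i x' y', [/\ K x', K y', (C `&` D `&` P) (S i x') & (C `&` D `&` Q) (S
    i y')].
Proof.
move=> sC sD CDPQ Cx Dx Px Cy Dy Qy.
have Kof z : C z -> K z by case: sC => _ _; exact.
have [i [x' [Kx' xE]]] := splitK (Kof _ Cx).
have [j [y' [Ky' yE]]] := splitK (Kof _ Cy).
subst x y.
have [ij|/eqP ij] := eqVneq i j; first by subst j; exists i, x', y'.
have KA := ts_tip sys.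
have jE a : exists2 c', K c' & joint a = S (Some a) c'.
  rewrite /joint; have [z Kz ->] := ts_joint sys a.
  by exists (S (Some (a + 1)) z) => //; exact: SK.
case: i ij Cx Dx Px => [a|] ij Cx Dx Px.
  have Ca : C (joint a) by apply: (subcontinuum_joint sC _ Kx' Ky' Cx Cy) =>
    ja; apply: ij.
  have Da : D (joint a) by apply: (subcontinuum_joint sD _ Kx' Ky' Dx Dy) =>
    ja; apply: ij.
  have [Pa|Qa] := CDPQ _ (conj Ca Da); last first.
    by have [c' Kc' cE] := jE a; exists (Some a), x', c'; rewrite -cE.
  case: j ij Cy Dy Qy => [b|] ij Cy Dy Qy; last by exists None, (A a), y'.
  have Cb : C (joint b) by apply: (subcontinuum_joint sC _ Ky' Kx' Cy Cx).
  have Db : D (joint b) by apply: (subcontinuum_joint sD _ Ky' Kx' Dy Dx).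
  have [Pb|Qb] := CDPQ _ (conj Cb Db); last by exists None, (A a), (A b).
  by have [c' Kc' cE] := jE b; exists (Some b), c', y'; rewrite -cE.
case: j ij Cy Dy Qy => [b|//] ij Cy Dy Qy.
have Cb : C (joint b) by apply: (subcontinuum_joint sC _ Ky' Kx' Cy Cx).
have Db : D (joint b) by apply: (subcontinuum_joint sD _ Ky' Kx' Dy Dx).
have [Pb|Qb] := CDPQ _ (conj Cb Db); last by exists None, x', (A b).
by have [c' Kc' cE] := jE b; exists (Some b), c', y'; rewrite -cE.
Qed.

(** Descending [n] levels with [split_joints] brings the two parts within [d * r ^ n]. Hence the
    intersection of two subcontinua never splits into two nonempty parts at positive distance. *)
Lemma subcontinuum_meet_chain d n C D P Q x y :
  (forall x y, K x -> K y -> edist x y <= d) ->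
  subcontinuum C -> subcontinuum D -> C `&` D `<=` P `|` Q ->
  C x -> D x -> P x -> C y -> D y -> Q y ->
  exists u v, [/\ (C `&` D `&` P) u, (C `&` D `&` Q) v & edist u v <= d * r ^+
    n].
Proof.
move=> Kd; elim: n => [|n IHn] in C D P Q x y * => sC sD CDPQ Cx Dx Px Cy Dy Qy.
  exists x, y; split=> //; rewrite expr0 mulr1.
  by case: sC => _ _ CK; apply: Kd; exact: CK.
have [i [x' [y' [Kx' Ky' [[Cx' Dx'] Px'] [[Cy' Dy'] Qy']]]]] :=
  split_joints sC sD CDPQ Cx Dx Px Cy Dy Qy.
have [|u [v [[[[_ Cu] [_ Du]] Pu] [[[_ Cv] [_ Dv]] Qv] uv]]] :=
  IHn (pull i C) (pull i D) (S i @^-1` P) (S i @^-1` Q) x' y'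
    (subcontinuum_pull i sC) (subcontinuum_pull i sD) _
    (conj Kx' Cx') (conj Kx' Dx') Px' (conj Ky' Cy') (conj Ky' Dy') Qy'.
  by move=> z [[_ Cz] [_ Dz]]; exact: CDPQ.
exists (S i u), (S i v); split=> //.
by apply: le_trans (S_le _ _ _) _; rewrite exprS mulrCA ler_wpM2l// ltW.
Qed.

(** * Arcs lie in every subcontinuum through their ends *)

Lemma arc_ends x y (gamma : set (plane R)) :
  is_arc x y gamma -> gamma x /\ gamma y.
Proof.
move=> [f [_ _ <- <- <-]].
by split; [exists 0|exists 1]; rewrite //= in_itv/= lexx ler01.
Qed.

Lemma arc_subcontinuum x y (gamma : set (plane R)) :
  is_arc x y gamma -> gamma `<=` K -> subcontinuum gamma.
Proof.
move=> [f [cf _ <- _ _]] gK; split=> //.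
  apply: compact_closed; first exact: plane_hausdorff.
  by apply: continuous_compact => //; exact: segment_compact.
by apply: connected_continuous_connected cf; exact: segment_connected.
Qed.

Lemma arc_sub_subcontinuum x y (gamma : set (plane R)) D :
  is_arc x y gamma -> gamma `<=` K -> subcontinuum D -> D x -> D y ->
  gamma `<=` D.
Proof.
move=> ga gK sD Dx Dy z gz; apply: contrapT => nDz.
have sg := arc_subcontinuum ga gK.
have [f [cf injf fg f0 f1]] := ga.
have clD : closed D by case: sD.
move: (gz); rewrite -fg => -[t0 /= t01 ft0]; have := t01.
rewrite in_itv/= => /andP[t0_ge0 t0_le1].
have seg (a b : R) : 0 <= a -> b <= 1 -> compact (f @` `[a, b] `&` D).
  move=> a0 b1; apply: compact_closedI => //; apply: continuous_compact.
    apply: continuous_subspaceW cf => s /=; rewrite !in_itv/= => /andP[as_ sb].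
    by rewrite (le_trans a0 as_) (le_trans sb b1).
  exact: segment_compact.
have cP := seg 0 t0 (lexx 0) t0_le1.
have cQ := seg t0 1 t0_ge0 (lexx 1).
(* By injectivity the two subarcs share only [z], which is not in [D]. The two compact parts of the
   intersection with [D] are thus at positive distance, against [subcontinuum_meet_chain]. *)
have PQ : (f @` `[0, t0] `&` D) `&` (f @` `[t0, 1] `&` D) = set0.
  apply/seteqP; split=> // u [[[a /= aI fa] Du] [[b /= bI fb] _]].
  move: aI bI; rewrite !in_itv/= => /andP[a0 at0] /andP[t0b b1].
  have ba : b = a.
    apply: injf; last by rewrite fa fb.
      by rewrite inE/= in_itv/= (le_trans t0_ge0 t0b) b1.
    by rewrite inE/= in_itv/= a0 (le_trans at0 t0_le1).
  have at0E : a = t0 by apply/eqP; rewrite eq_le at0 -ba t0b.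
  by apply: nDz; rewrite -ft0 -at0E fa.
have [d d0 Kd] := boundK; have [e e0 gap] := compact_edist_gap cP cQ PQ.
have [n ne] := expr_small d r01 e0.
have [gx gy] := arc_ends ga.
have [|||u [v [[_ Pu] [_ Qv] uv]]] := subcontinuum_meet_chain n Kd sg sD _
  gx Dx (_ : (f @` `[0, t0] `&` D) x) gy Dy (_ : (f @` `[t0, 1] `&` D) y).
- move=> u [gu Du]; move: gu; rewrite -fg => -[a /= + fa].
  rewrite in_itv/= => /andP[a0 a1]; have [at0|/ltW t0a] := leP a t0;
    [left|right].
    by split=> //; exists a => //=; rewrite in_itv/= a0.
  by split=> //; exists a => //=; rewrite in_itv/= t0a.
- by split=> //; exists 0 => //=; rewrite in_itv/= lexx.
- by split=> //; exists 1 => //=; rewrite in_itv/= lexx andbT.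
by have := gap u v Pu Qv; rewrite leNgt (le_lt_trans uv ne).
Qed.

(** * Copies of the pairs (O, A_b) inside a subcontinuum *)

Lemma subcontinuum_center C a b :
  subcontinuum C -> a != b -> C (A a) -> C (A b) -> C O.
Proof.
move=> sC ab Ca Cb; have [d d0 Kd] := boundK.
(* A subcontinuum through two tips contains both joints, so its central pullback contains the same
   two tips. Iterating [n] times gives a point of it within [d * r ^ n] of the fixed point [O]. *)
have near n : forall D, subcontinuum D -> D (A a) -> D (A b) ->
    exists2 z, D z & edist O z <= d * r ^+ n.
  elim: n => [|n IHn] D sD Da Db.
    exists (A a) => //; rewrite expr0 mulr1; apply: Kd.
      exact: ts_center sys.
    exact: ts_tip sys _.
  have [t Kt aE] := ts_joint sys a; have [u Ku bE] := ts_joint sys b.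
  have Dja : D (joint a).
    apply: (subcontinuum_joint sD (j := Some b) _ (ts_tip sys a) (ts_tip sys
      b));
      rewrite ?(ts_tip_fix sys)//.
    by case=> ba; rewrite ba eqxx in ab.
  have Djb : D (joint b).
    apply: (subcontinuum_joint sD (j := Some a) _ (ts_tip sys b) (ts_tip sys
      a));
      rewrite ?(ts_tip_fix sys)//.
    by case=> ba; rewrite ba eqxx in ab.
  have [z [Kz Dz] Oz] := IHn _ (subcontinuum_pull None sD)
    (conj (ts_tip sys a) Dja) (conj (ts_tip sys b) Djb).
  exists (S None z) => //; rewrite -(ts_center_fix sys).
  by apply: le_trans (S_le _ _ _) _; rewrite exprS mulrCA ler_wpM2l// ltW.
case: (sC) => clC _ _; apply: closed_edist => // e e0.
have [n ne] := expr_small d r01 e0.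
by have [z Cz Oz] := near n C sC Ca Cb; exists z => //; exact: le_lt_trans ne.
Qed.

(** [C] contains B_a, which lies in the piece [a] and, within it, in the subpiece [a + 1]. The
    pullback [D] thus meets two of its corner pieces and contains the joints at [a] and [a + 1]; its
    central pullback contains two tips and hence [O]. *)
Lemma subcontinuum_rotate C a : subcontinuum C -> C O -> C (A a) ->
  C (S (Some a) O) /\
  exists w, C (wmap w O) /\ C (wmap w (A (a + 1))).
Proof.
move=> sC CO Ca; have KA := ts_tip sys; have KO := ts_center sys.
have a1a : a + 1 != a by rewrite -subr_eq0 addrAC subrr add0r.
have [z Kz aE] := ts_joint sys a.
have Cja : C (joint a).
  apply: (subcontinuum_joint sC (j := None) _ (KA a) KO) => //.
    by rewrite (ts_tip_fix sys).
  by rewrite (ts_center_fix sys).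
pose D := pull (Some a) C; have sD : subcontinuum D by exact: subcontinuum_pull.
have Da : D (A a) by split=> //; rewrite (ts_tip_fix sys).
have Dz : D (S (Some (a + 1)) z) by split; [exact: SK|rewrite -aE].
have Dja : D (joint a).
  apply: (subcontinuum_joint sD (j := Some (a + 1)) _ (KA a) Kz) => //.
    by case=> /eqP; apply/negP.
  by rewrite (ts_tip_fix sys).
have Djb : D (joint (a + 1)).
  apply: (subcontinuum_joint sD (j := Some a) _ Kz (KA a)) => //.
    by case=> /esym/eqP; apply/negP.
  by rewrite (ts_tip_fix sys).
have sE := subcontinuum_pull None sD.
have [_ [_ DO]] : pull None D O.
  by apply: (subcontinuum_center sE a1a); split=> //; exact: KA.
split; first by rewrite (ts_center_fix sys) in DO.
by exists [:: Some a; None]; split=> //; case: Djb.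
Qed.

Lemma subcontinuum_rotates C a b : subcontinuum C -> C O -> C (A a) ->
  exists w, C (wmap w O) /\ C (wmap w (A b)).
Proof.
move=> sC CO Ca; suff h k : forall C a, subcontinuum C -> C O -> C (A a) ->
    exists w, C (wmap w O) /\ C (wmap w (A (a + k%:R))).
  (* Indices are taken in Z/3: [b] is reached from [a] by rotating as many times as the
     representative of [b - a]. *)
  have [w] := h (b - a : 'I_3) C a sC CO Ca.
  by rewrite natr_Zp addrC subrK => ?; exists w.
elim: k => [|k IHk] {}C {}a {}sC {}CO {}Ca; first by exists [::]; rewrite addr0.
have [_ [w [wO wA]]] := subcontinuum_rotate sC CO Ca.
have [v [[_ vO] [_ vA]]] := IHk (pullw w C) (a + 1) (subcontinuum_pullw w sC)
  (conj (ts_center sys) wO) (conj (ts_tip sys _) wA).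
exists (w ++ v); rewrite /wmap !foldr_cat; split=> //.
by rewrite -natr1 [k%:R + 1]addrC addrA.
Qed.

Lemma subcontinuum_two_tips C a b c : subcontinuum C -> a != b ->
  C (A a) -> C (A b) -> exists w, C (wmap w O) /\ C (wmap w (A c)).
Proof.
move=> sC ab Ca Cb; apply: (subcontinuum_rotates c sC _ Ca).
exact: subcontinuum_center sC ab Ca Cb.
Qed.

Let lift_word i C b :
  (exists w, pull i C (wmap w O) /\ pull i C (wmap w (A b))) ->
  exists w, C (wmap w O) /\ C (wmap w (A b)).
Proof. by move=> [w [[_ ?] [_ ?]]]; exists (i :: w). Qed.

(** Each pullback lowers the exponent by one; this drives the two inductions below, whose base case
    is excluded because [d] bounds all distances in [K]. *)
Let far_pull d n i x y : d * r ^+ n.+1 < edist (S i x) (S i y) -> d * r ^+ n <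
  edist x y.
Proof.
move=> h; rewrite -(ltr_pM2l r0) mulrCA -exprS.
exact: lt_le_trans h (S_le _ _ _).
Qed.

Let two_joints C a b x y c : subcontinuum C -> a != b -> K x -> K y ->
  C (S (Some a) x) -> C (S (Some b) y) ->
  exists w, C (wmap w O) /\ C (wmap w (A c)).
Proof.
move=> sC ab Kx Ky Cx Cy; apply: (@lift_word None).
have ba : b != a by rewrite eq_sym.
apply: (@subcontinuum_two_tips _ a b c (subcontinuum_pull None sC) ab);
  (split; first exact: ts_tip sys _).
  by apply: (subcontinuum_joint sC (j := Some b) _ Kx Ky Cx Cy) => -[/eqP];
    apply/negP.
by apply: (subcontinuum_joint sC (j := Some a) _ Ky Kx Cy Cx) => -[/eqP];
  apply/negP.
Qed.

(** While [x] stays in the corner piece of the fixed point [A a], both points are pulled back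
    through it and move apart. Once [x] leaves that piece, [two_joints] applies, to [C] or to its
    pullback. *)
Lemma subcontinuum_tip C x a b : subcontinuum C -> C x -> C (A a) -> x <> A a ->
  exists w, C (wmap w O) /\ C (wmap w (A b)).
Proof.
move=> sC Cx Ca xa; have [d d0 Kd] := boundK; have KA := ts_tip sys.
have /(expr_small d r01)[n] : 0 < edist x (A a) by exact: edist_gt0.
elim: n => [|n IHn] in C x sC Cx Ca xa *.
  rewrite expr0 mulr1 ltNge Kd//; first by case: sC => _ _; exact.
have Kx : K x by case: sC => _ _; exact.
have [i [x' [Kx' xE]]] := splitK Kx; subst x => far.
have sP := subcontinuum_pull (Some a) sC.
have PA : pull (Some a) C (A a) by split=> //; rewrite (ts_tip_fix sys).
have [ia|/eqP ia] := eqVneq i (Some a).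
  subst i; apply: (@lift_word (Some a)); apply: (IHn _ x' sP) => //.
    by move=> xA; apply: xa; rewrite xA (ts_tip_fix sys).
  by apply: (far_pull (i := Some a)); rewrite (ts_tip_fix sys).
case: i => [b'|] in ia Kx Cx xa far *.
  apply: (@two_joints C b' a x' (A a)) => //; last by case: PA.
  by apply/eqP => ba; apply: ia; rewrite ba.
(* Here [x] is in the central piece. [C] contains B_a, whose preimage lies in the subpiece [a + 1],
   so the pullback through [a] meets two of its corner pieces. *)
apply: (@lift_word (Some a)).
have Ca' : C (joint a) by apply: (subcontinuum_joint sC ia (KA a) Kx');
  case: PA.
have [z Kz aE] := ts_joint sys a.
apply: (@two_joints _ a (a + 1) (A a) z b sP _ (KA a) Kz).
- by rewrite eq_sym -subr_eq0 addrAC subrr add0r.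
- by rewrite (ts_tip_fix sys).
- by split; [exact: SK|rewrite -aE].
Qed.

(** Points in a common piece are pulled back until no piece contains both. Then either two corner
    pieces are met, or one point is central; the latter is not the joint, which would lie in the
    other point's piece too, so [subcontinuum_tip] applies to the central pullback. *)
Lemma subcontinuum_pair C x y b : subcontinuum C -> C x -> C y -> x <> y ->
  exists w, C (wmap w O) /\ C (wmap w (A b)).
Proof.
move=> sC Cx Cy xy; have [d d0 Kd] := boundK; have KA := ts_tip sys.
have /(expr_small d r01)[n] : 0 < edist x y by exact: edist_gt0.
elim: n => [|n IHn] in C x y sC Cx Cy xy *.
  by rewrite expr0 mulr1 ltNge Kd//; case: sC => _ _; exact.
have Kof z : C z -> K z by case: sC => _ _; exact.
have [[i [x' [y' [Kx' Ky' xE yE]]]]|sep far] :=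
    pselect (exists i x' y', [/\ K x', K y', x = S i x' & y = S i y']).
  subst x y => far; apply: (@lift_word i).
  apply: (IHn _ x' y' (subcontinuum_pull i sC)) => //.
    by move=> xy'; apply: xy; rewrite xy'.
  exact: (far_pull (i := i)).
have center z a u : K z -> K u -> C (S None z) -> C (S (Some a) u) ->
    z <> A a -> exists w, C (wmap w O) /\ C (wmap w (A b)).
  move=> Kz Ku Cz Cu zA; apply: (@lift_word None).
  apply: (subcontinuum_tip b (subcontinuum_pull None sC) (conj Kz Cz) _ zA).
  by split=> //; apply: (subcontinuum_joint sC (j := None) _ Ku Kz Cu Cz).
have tip_sep a : exists2 c, K c & S None (A a) = S (Some a) c.
  have [c Kc ->] := ts_joint sys a.
  by exists (S (Some (a + 1)) c) => //; exact: SK.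
have [i [x' [Kx' xE]]] := splitK (Kof _ Cx);
  have [j [y' [Ky' yE]]] := splitK (Kof _ Cy).
subst x y; case: i j => [a|] [a'|] in xy sep far Cx Cy *.
- apply: (@two_joints C a a' x' y') => //; apply/eqP => aa'; apply: sep.
  by exists (Some a), x', y'; rewrite aa'.
- apply: (center y' a x') => // yA; apply: sep; have [c Kc cE] := tip_sep a.
  by exists (Some a), x', c; rewrite -cE yA.
- apply: (center x' a' y') => // xA; apply: sep; have [c Kc cE] := tip_sep a'.
  by exists (Some a'), c, y'; rewrite -cE xA.
- by exfalso; apply: sep; exists None, x', y'.
Qed.

(** * Images under words and the comparison of dimensions *)

Let wmap_sim w : exists2 c, 0 < c &
  forall x y, edist (wmap w x) (wmap w y) = c * edist x y.
Proof.
elim: w => [|i w [c c0 cE]]; first by exists 1 => // x y; rewrite mul1r.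
exists (q i * c); first by rewrite mulr_gt0.
by move=> x y; rewrite /= (ts_sim sys) cE mulrA.
Qed.

Lemma hausdorff_null_pullw (t : R) w C : 0 <= t ->
  hausdorff_measure t C = 0%E -> hausdorff_measure t (pullw w C) = 0%E.
Proof.
have [c c0 cE] := wmap_sim w => t0.
apply: (hausdorff_null_expand (g := wmap w) (L := c^-1)) => //.
- by rewrite invr_gt0.
- by move=> x [].
- by move=> x y _ _; rewrite cE mulKf// gt_eqF.
Qed.

Lemma hausdorff_null_wmap (t : R) w C : 0 <= t ->
  hausdorff_measure t C = 0%E -> hausdorff_measure t (wmap w @` C) = 0%E.
Proof.
by have [c c0 cE] := wmap_sim w => t0; exact: hausdorff_null_image cE.
Qed.

Section Spine.
Variable T : set (plane R).
Hypothesis sT : subcontinuum T.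
Hypothesis TO : T O.
Hypothesis TS : forall a, T (S (Some a) O).

Let TSO i : T (S i O).
Proof. by case: i => [a|]; rewrite ?(ts_center_fix sys). Qed.

(** If [D] contains [O], then [T] and the image of [D] under [S i] meet at [S i O]. Gluing
    repeatedly gives subcontinua through [O] that come arbitrarily close to any point of [K], so the
    closed component of [O] is [K]. *)
Lemma attractor_connected : connected K.
Proof.
have [d d0 Kd] := boundK; have KO := ts_center sys.
have near n : forall x, K x -> exists D,
    [/\ subcontinuum D, D O & exists2 y, D y & edist x y <= d * r ^+ n].
  elim: n => [|n IHn] x Kx.
    exists T; split=> //; exists O => //.
    by rewrite expr0 mulr1 Kd.
  have [i [x' [Kx' ->]]] := splitK Kx; have [D [sD DO [y Dy xy]]] := IHn x' Kx'.
  exists (T `|` (S i @` D)); split; last 2 first.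
  - by left.
  - exists (S i y); first by right; exists y.
    by apply: le_trans (S_le _ _ _) _; rewrite exprS mulrCA ler_wpM2l// ltW.
  by apply: (subcontinuumU (TSO i) _ sT (subcontinuum_push i sD)); exists O.
rewrite (_ : K = connected_component K O); first exact: component_connected.
apply/seteqP; split=> [x Kx|]; last exact: connected_component_sub.
apply: closed_edist => [|e e0]; first exact: component_closed.
have [n ne] := expr_small d r01 e0.
have [D [[_ cD DK] DO [y Dy xy]]] := near n x Kx.
by exists y; [exists D|exact: le_lt_trans ne].
Qed.

(** The same gluing, started from [K] itself so that [x] is really reached: after [n] steps all but
    a part near [x] consists of images of [T]. *)
Lemma subcontinuum_to_center d n x :
  (forall x y, K x -> K y -> edist x y <= d) -> K x ->
  exists D, [/\ subcontinuum D, D O, D x & forall z, D z ->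
    (exists w, (wmap w @` T) z) \/ edist x z <= d * r ^+ n].
Proof.
move=> Kd; elim: n x => [|n IHn] x Kx.
  exists K; split=> //; [|exact: ts_center sys|].
    by split=> //; exact: attractor_connected.
  by move=> z Kz; right; rewrite expr0 mulr1 Kd.
have [i [x' [Kx' ->]]] := splitK Kx; have [D [sD DO Dx Dz]] := IHn x' Kx'.
exists (T `|` (S i @` D)); split.
- by apply: (subcontinuumU (TSO i) _ sT (subcontinuum_push i sD)); exists O.
- by left.
- by right; exists x'.
- move=> z [Tz|[z' Dz' <-]]; first by left; exists [::]; exists z.
  have [[w [t Tt <-]]|xz] := Dz z' Dz'; first by left; exists (i :: w);
    exists t.
  right; apply: le_trans (S_le _ _ _) _.
  by rewrite exprS mulrCA ler_wpM2l// ltW.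
Qed.

Lemma arc_sub_spine x y (gamma : set (plane R)) :
  is_arc x y gamma -> gamma `<=` K ->
  gamma `<=` [set x] `|` [set y] `|` \bigcup_w (wmap w @` T).
Proof.
move=> ga gK z gz; have [d d0 Kd] := boundK;
  have [/gK Kx /gK Ky] := arc_ends ga.
have [->|zx] := pselect (z = x); first by left; left.
have [->|zy] := pselect (z = y); first by left; right.
have e0 : 0 < Num.min (edist x z) (edist y z).
  by rewrite lt_min !edist_gt0// => /esym.
have [n] := expr_small d r01 e0; rewrite lt_min => /andP[nx ny].
have [C [sC CO Cx Cz]] := subcontinuum_to_center n Kd Kx.
have [D [sD DO Dy Dz]] := subcontinuum_to_center n Kd Ky.
(* The two subcontinua join at [O] and so contain the arc; [z] is too far from both ends to lie
   outside the images of [T]. *)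
have sU : subcontinuum (C `|` D) by exact: subcontinuumU CO DO sC sD.
have [/Cz|/Dz] := arc_sub_subcontinuum ga gK sU (or_introl Cx) (or_intror Dy)
  gz.
  by move=> [[w wz]|]; [right; exists w|rewrite leNgt nx].
by move=> [[w wz]|]; [right; exists w|rewrite leNgt ny].
Qed.

End Spine.

Lemma hausdorff_null_arc (t : R) x y (gamma gamma' : set (plane R)) :
  0 < t -> is_arc O (A 0) gamma -> gamma `<=` K ->
  is_arc x y gamma' -> gamma' `<=` K ->
  hausdorff_measure t gamma = 0%E -> hausdorff_measure t gamma' = 0%E.
Proof.
move=> t0 ga gK ga' gK' g0; have sg := arc_subcontinuum ga gK.
have [gO g1] := arc_ends ga.
have /choice[v vP] : forall a, exists w, gamma (wmap w O) /\ gamma (wmap w (A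
  a)).
  by move=> a; exact: subcontinuum_rotates sg gO g1.
(* The word [v a] carries the pair (O, A_a) into [gamma], so every pullback contains [O] and [A a],
   and by [subcontinuum_rotate] also the image of [O] under [S (Some a)]. [T] is null whenever
   [gamma] is, and there are countably many words. *)
pose T := \bigcup_a pullw (v a) gamma.
have TO a : pullw (v a) gamma O by split; [exact: ts_center sys|case: (vP a)].
have sv a : subcontinuum (pullw (v a) gamma) by exact: subcontinuum_pullw.
have sT : subcontinuum T.
  split.
  - by apply: closed_bigcup => [|a _]; [exact: finite_finset|case: (sv a)].
  - apply: bigcup_connected => [|a _]; last by case: (sv a).
    by exists O => a _; exact: TO.
  - by move=> z [a _ []].
have TS a : T (S (Some a) O).
  exists a => //; apply: (subcontinuum_rotate (sv a) (TO a) _).1.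
  by split; [exact: ts_tip sys _|case: (vP a)].
have TO' : T O by exists 0.
apply: (hausdorff_null_sub (ltW t0) (arc_sub_spine sT TO' TS ga' gK')).
apply: hausdorff_null_setU; rewrite ?(ltW t0)//.
  by apply: hausdorff_null_setU; rewrite ?(ltW t0)//; exact: hausdorff_null1.
apply: hausdorff_null_bigcup; rewrite ?(ltW t0)// => w.
apply: hausdorff_null_wmap; rewrite ?(ltW t0)//.
apply: hausdorff_null_bigcup; rewrite ?(ltW t0)// => a.
by apply: hausdorff_null_pullw; rewrite ?(ltW t0).
Qed.

Theorem hausdorff_dim_arc x y (gamma gamma' : set (plane R)) :
  is_arc O (A 0) gamma -> gamma `<=` K ->
  x <> y -> is_arc x y gamma' -> gamma' `<=` K ->
  hausdorff_dim gamma' = hausdorff_dim gamma.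
Proof.
move=> ga gK xy ga' gK'; apply/eqP; rewrite eq_le; apply/andP; split.
  (* The endpoints are null only for positive exponents; at exponent 0 the nonempty [gamma] is not
     null. *)
  apply: hausdorff_dim_le => t; rewrite le_eqVlt => /orP[/eqP <-|t0].
    move=> /eqP; apply: contraPeq => _; apply/negP/hausdorff_measure0_neq0.
    by exists O; case: (arc_ends ga).
  exact: hausdorff_null_arc ga gK ga' gK'.
have sg' := arc_subcontinuum ga' gK'.
have [gx gy] := arc_ends ga'.
have [w [wO wA]] := subcontinuum_pair 0 sg' gx gy xy.
(* The pullback of [gamma'] is a subcontinuum containing [O] and [A 0], hence the whole arc between
   them. *)
have gw : gamma `<=` pullw w gamma'.
  apply: (arc_sub_subcontinuum ga gK (subcontinuum_pullw w sg')).
    by split=> //; exact: ts_center sys.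
  by split=> //; exact: ts_tip sys _.
apply: hausdorff_dim_le => t t0 g0; apply: (hausdorff_null_sub t0 gw).
exact: hausdorff_null_pullw.
Qed.

End Tripod.

(** * The triangle in barycentric coordinates *)

Section Triangle.
Context {R : realType}.
Implicit Types (x y z : plane R) (a b c : 'I_3) (p : R).

Definition tip a : plane R := tnth [tuple A1 R; A2 R; A3 R] a.

Definition bary a z : R :=
  tnth [tuple 1 - z.1 - z.2 / Num.sqrt 3; z.1 - z.2 / Num.sqrt 3;
              2 * (z.2 / Num.sqrt 3)] a.

Definition triangle : set (plane R) := [set z | forall a, 0 <= bary a z].

Lemma ord3_ind (P : 'I_3 -> Prop) : P 0 -> P 1 -> P (1 + 1) -> forall a, P a.
Proof.
move=> P0 P1 P2 [[|[|[|//]]] ha].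
- by rewrite (_ : Ordinal ha = 0)//; exact: val_inj.
- by rewrite (_ : Ordinal ha = 1)//; exact: val_inj.
- by rewrite (_ : Ordinal ha = 1 + 1)//; exact: val_inj.
Qed.

Lemma sum_ord3 (F : 'I_3 -> R) : \sum_a F a = F 0 + F 1 + F (1 + 1).
Proof.
rewrite !big_ord_recl big_ord0 addr0 addrA; congr (_ + F _ + F _);
  exact: val_inj.
Qed.

Lemma tnth3 (T : Type) (x y z : T) :
  (tnth [tuple x; y; z] 0 = x) * (tnth [tuple x; y; z] 1 = y) *
  (tnth [tuple x; y; z] (1 + 1) = z).
Proof. by []. Qed.

Let sqrt3_neq0 : Num.sqrt 3 != 0 :> R.
Proof. by rewrite sqrtr_eq0 -ltNge. Qed.

Let sqrt3_sqr : Num.sqrt 3 ^+ 2 = 3 :> R.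
Proof. by rewrite sqr_sqrtr. Qed.

Lemma bary_sum z : \sum_a bary a z = 1.
Proof. by rewrite sum_ord3 /bary !tnth3; field. Qed.

Lemma bary_tip a b : bary b (tip a) = (b == a)%:R.
Proof.
by elim/ord3_ind: a; elim/ord3_ind: b;
  rewrite -val_eqE /bary /tip !tnth3 /A1 /A2 /A3 /=; field.
Qed.

Lemma bary_inj x y : (forall a, bary a x = bary a y) -> x = y.
Proof.
move=> xy; have := xy 1; have := xy (1 + 1); rewrite /bary !tnth3 => h1 h2.
have {}h1 : x.2 / Num.sqrt 3 = y.2 / Num.sqrt 3 by lra.
have {}h2 : x.1 = y.1 by lra.
move/mulIf: h1; rewrite invr_eq0 => /(_ sqrt3_neq0).
by case: x y h2 {xy} => x1 x2 [y1 y2] /= -> ->.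
Qed.

Lemma bary_affine b (t : R) x y :
  bary b (t *: x + (1 - t) *: y) = t * bary b x + (1 - t) * bary b y.
Proof.
rewrite (_ : t *: x + _ = (t * x.1 + (1 - t) * y.1, t * x.2 + (1 - t) * y.2))//.
by elim/ord3_ind: b; rewrite /bary !tnth3/=; field.
Qed.

Lemma edist_bary x y : edist x y ^+ 2 = (\sum_a (bary a x - bary a y) ^+ 2) / 2.
Proof.
have z2 z : z.2 = z.2 / Num.sqrt 3 * Num.sqrt 3 by rewrite divfK.
rewrite sum_ord3 edist_sqr /bary !tnth3 [x.2 in LHS]z2 [y.2 in LHS]z2.
rewrite -mulrBl exprMn sqrt3_sqr; by field.
Qed.

Lemma triangle_le1 a z : triangle z -> bary a z <= 1.
Proof.
move=> tz; rewrite -(bary_sum z) (bigD1 a)//= lerDl sumr_ge0// => b _;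
  exact: tz.
Qed.

Lemma bary_continuous a : continuous (bary a).
Proof.
have c1 : continuous (fun z : plane R => z.1) by move=> z; exact: cvg_fst.
have c2 : continuous (fun z : plane R => z.2 / Num.sqrt 3).
  by move=> z; apply: cvgM; [exact: cvg_snd|exact: cvg_cst].
elim/ord3_ind: a; rewrite /bary => z.
- rewrite (_ : (fun _ => _) = fun z => 1 - z.1 - z.2 / Num.sqrt 3)//.
  by apply: cvgB; [apply: cvgB; [exact: cvg_cst|exact: c1]|exact: c2].
- rewrite (_ : (fun _ => _) = fun z => z.1 - z.2 / Num.sqrt 3)//.
  by apply: cvgB; [exact: c1|exact: c2].
- rewrite (_ : (fun _ => _) = fun z => 2 * (z.2 / Num.sqrt 3))//.
  by apply: cvgM; [exact: cvg_cst|exact: c2].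
Qed.

Lemma triangle_closed : closed triangle.
Proof.
rewrite (_ : triangle = \bigcap_a [set z | 0 <= bary a z]); last first.
  by apply/seteqP; split=> z tz a; [move=> _; exact: tz|exact: tz a I].
apply: closed_bigI => a _.
apply: (@preimage_closed _ _ (bary a) [set t | 0 <= t]); last exact: closed_ge.
move=> z _; apply: bary_continuous.
Qed.

Lemma segment_bary a b z c : segment (tip a) (tip b) z ->
  0 <= bary c z /\ (c != a -> c != b -> bary c z = 0).
Proof.
move=> [t /=]; rewrite in_itv/= => /andP[t0 t1] <-.
rewrite -{2 4}(subKr 1 t) bary_affine !bary_tip; split.
  by rewrite subKr addr_ge0// mulr_ge0// subr_ge0.
by move=> /negbTE-> /negbTE->; rewrite !mulr0 addr0.
Qed.

Definition corner_map (p1 p2 p3 : R) a : plane R -> plane R :=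
  tnth [tuple S1 p1; S2 p2; S3 p3] a.

Lemma corner_mapE p1 p2 p3 a z : corner_map p1 p2 p3 a z =
  tnth [tuple p1; p2; p3] a *: z + (1 - tnth [tuple p1; p2; p3] a) *: tip a.
Proof.
elim/ord3_ind: a; rewrite /corner_map /tip !tnth3 ?/S1 ?/S2 ?/S3 scalerBl
  scale1r.
- by rewrite (_ : A1 R = 0)// scaler0 subr0 addr0.
- by rewrite addrAC addrA.
- by rewrite addrAC addrA.
Qed.

Lemma corner_map_edist p1 p2 p3 a x y :
  edist (corner_map p1 p2 p3 a x) (corner_map p1 p2 p3 a y) =
  `|tnth [tuple p1; p2; p3] a| * edist x y.
Proof.
rewrite !corner_mapE; set p := tnth _ _.
have h (u v w : plane R) : edist (p *: u + w) (p *: v + w) = `|p| * edist u v.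
  apply/eqP; rewrite -(@eqrXn2 _ 2%N)// ?mulr_ge0 ?edist_ge0//.
  rewrite exprMn real_normK ?num_real// !edist_sqr.
  rewrite (_ : p *: u + w = (p * u.1 + w.1, p * u.2 + w.2))//.
  rewrite (_ : p *: v + w = (p * v.1 + w.1, p * v.2 + w.2))//=.
  by apply/eqP; ring.
exact: h.
Qed.

Definition mix (l : 'I_3 -> R) (P : 'I_3 -> plane R) : plane R :=
  (\sum_a l a * (P a).1, \sum_a l a * (P a).2).

Lemma mix_tip z : mix (bary^~ z) tip = z.
Proof.
rewrite /mix !sum_ord3 /bary /tip !tnth3 /A1 /A2 /A3/=.
by case: z => z1 z2 /=; congr pair; field.
Qed.

(* Leibniz' identity: the right-hand side involves distances only. *)
Lemma edist_mix (l : 'I_3 -> R) (P : 'I_3 -> plane R) z : \sum_a l a = 1 ->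
  edist z (mix l P) ^+ 2 = \sum_a l a * edist z (P a) ^+ 2 -
    (\sum_a \sum_b l a * l b * edist (P a) (P b) ^+ 2) / 2.
Proof.
rewrite !sum_ord3 !edist_sqr /mix /= !sum_ord3 => l1.
have -> : l 0 = 1 - l 1 - l (1 + 1) by rewrite -l1; ring.
by field.
Qed.

Lemma bary_mix (l : 'I_3 -> R) (P : 'I_3 -> plane R) b : \sum_a l a = 1 ->
  bary b (mix l P) = \sum_a l a * bary b (P a).
Proof.
rewrite /mix !sum_ord3 => l1.
have -> : l 0 = 1 - l 1 - l (1 + 1) by rewrite -l1; ring.
by elim/ord3_ind: b; rewrite /bary !tnth3/=; field.
Qed.

(** Similarities are affine: [edist_mix] expresses the squared distance of the two sides by
    distances alone, so it is [q ^ 2] times its value for the identity map, which is 0. *)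
Lemma sim_mix (q : R) (f : plane R -> plane R) z :
  (forall x y, edist (f x) (f y) = q * edist x y) ->
  f z = mix (bary^~ z) (f \o tip).
Proof.
move=> fq; apply: edist_eq0; apply/eqP; rewrite -sqrf_eq0 edist_mix ?bary_sum//.
have := edist_mix tip z (bary_sum z); rewrite mix_tip edistxx expr2 mul0r => h.
apply/eqP; transitivity (q ^+ 2 * 0 : R); last by rewrite mulr0.
rewrite [in RHS]h mulrBr mulrA !mulr_sumr; congr (_ - _ / _).
  by apply: eq_bigr => a _; rewrite /= fq exprMn mulrCA.
apply: eq_bigr => a _; rewrite mulr_sumr; apply: eq_bigr => b _.
by rewrite /= fq exprMn mulrCA.
Qed.

(** The left-hand side is u^2 - u v + v^2, at most the square of the larger of [u] and [v]. *)
Lemma hexagon_lt1 (u v : R) : 0 < u < 1 -> 0 < v < 1 ->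
  (u ^+ 2 + v ^+ 2 + (v - u) ^+ 2) / 2 < 1.
Proof.
move=> /andP[u0 u1] /andP[v0 v1]; have [uv|vu] := leP u v.
  by nra.
by nra.
Qed.

(** * From admissible parameters to a tripod system *)

Lemma tuple4_bigcup (S0 : plane R -> plane R) p1 p2 p3 (K : set (plane R)) :
  \bigcup_(i : 'I_4) (tnth [tuple S0; S1 p1; S2 p2; S3 p3] i @` K) =
  \bigcup_i (oapp (corner_map p1 p2 p3) S0 i @` K).
Proof.
apply/seteqP; split=> [z [[[|[|[|[|//]]]] hi] _ Sz]|z [[a|] _ Sz]].
- by exists None.
- by exists (Some 0).
- by exists (Some 1).
- by exists (Some (1 + 1)).
- elim/ord3_ind: a Sz => Sz.
  + by exists (Ordinal (isT : 1 < 4)%N).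
  + by exists (Ordinal (isT : 2 < 4)%N).
  + by exists (Ordinal (isT : 3 < 4)%N).
- by exists ord0.
Qed.

Lemma admissible_tripod (p1 p2 p3 : R) (B1 B2 B3 : plane R)
    (S0 : plane R -> plane R) (K : set (plane R)) (O : plane R) :
  admissible p1 p2 p3 B1 B2 B3 -> similarity S0 ->
  [/\ S0 (A1 R) = B1, S0 (A2 R) = B2 & S0 (A3 R) = B3] ->
  is_attractor [tuple S0; S1 p1; S2 p2; S3 p3] K -> S0 O = O -> K O ->
  exists q r, tripod_system (oapp (corner_map p1 p2 p3) S0) q r K tip O.
Proof.
move=> [[p1_gt0 p2_gt0 p3_gt0] psum _ [K' [K'0 cK' K'E] [[K'B1 hB1] [K'B2 hB2]
  [K'B3 hB3]]]].
move=> [q q0 S0q] [S0A1 S0A2 S0A3] [K0 cK KE] S0O KO.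
pose p a := tnth [tuple p1; p2; p3] a; pose F := corner_map p1 p2 p3.
have p_gt0 a : 0 < p a by elim/ord3_ind: a; rewrite /p tnth3.
have p_lt1 a b : a != b -> p a + p b < 1.
  by elim/ord3_ind: a; elim/ord3_ind: b => // _; rewrite /p !tnth3; lra.
have p_le a : p a <= p1 + p2 + p3 by elim/ord3_ind: a; rewrite /p tnth3; lra.
have FE a z b : bary b (F a z) = p a * bary b z + (1 - p a) * (b == a)%:R.
  by rewrite /F corner_mapE bary_affine bary_tip.
have Fd a x y : edist (F a x) (F a y) = p a * edist x y.
  by rewrite /F corner_map_edist ger0_norm// ltW.
have Ftri a z : triangle z -> triangle (F a z).
  move=> tz b; rewrite FE addr_ge0// mulr_ge0//; first exact: ltW.
  rewrite subr_ge0; have := p_le a; lra.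
have K'tri : K' `<=` triangle.
  apply: (ifs_attract (S := F) (r := p1 + p2 + p3)) => //.
  - by apply/andP; split; lra.
  - by move=> a x y; rewrite Fd ler_wpM2r// edist_ge0.
  - by rewrite {1}K'E.
  - exact: triangle_closed.
  - by exists (tip 0) => b; rewrite bary_tip.
(* The three conditions on B_1, B_2, B_3, uniformly in Z/3: [s] lies on the side opposite to
   [tip a]. Hence B_a has [a]-th coordinate exactly [1 - p a] and its other coordinates are at most
   [p a]. *)
have BP a : K' (S0 (tip a)) /\ exists s, [/\ triangle s, bary a s = 0 &
    S0 (tip a) = F a (F (a + 1) s)].
  have pr c d s : segment (tip c) (tip d) s -> triangle s.
    by move=> h b; case: (segment_bary b h).
  elim/ord3_ind: a; rewrite /tip tnth3.
  - rewrite S0A1; split=> //; case: hB1 => s hs sE; exists s; split=> //.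
      exact: (pr 1 (1 + 1)).
    by have [_] := segment_bary (a := 1) (b := 1 + 1) 0 hs; apply.
  - rewrite S0A2; split=> //; case: hB2 => s hs sE; exists s; split=> //.
      exact: (pr 0 (1 + 1)).
    by have [_] := segment_bary (a := 0) (b := 1 + 1) 1 hs; apply.
  - rewrite S0A3; split=> //; case: hB3 => s hs sE; exists s; split=> //.
      exact: (pr 0 1).
    by have [_] := segment_bary (a := 0) (b := 1) (1 + 1) hs; apply.
have Btri a : triangle (S0 (tip a)) by apply: K'tri; case: (BP a).
have Bdiag a : bary a (S0 (tip a)) = 1 - p a.
  have [_ [s [_ s0 ->]]] := BP a; rewrite !FE s0 eqxx.
  by rewrite eq_sym -subr_eq0 addrAC subrr add0r/=; lra.
have Boff a c : a != c -> bary a (S0 (tip c)) <= p c.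
  move=> ac; have [_ [s [ts _ ->]]] := BP c.
  rewrite FE (negbTE ac) mulr0 addr0 ler_piMr//; first exact: ltW.
  exact/triangle_le1/Ftri.
have S0E b z : bary b (S0 z) = \sum_a bary a z * bary b (S0 (tip a)).
  by rewrite (sim_mix z S0q) bary_mix ?bary_sum.
have S0tri z : triangle z -> triangle (S0 z).
  by move=> tz b; rewrite S0E sumr_ge0// => a _; rewrite mulr_ge0//;
    exact: Btri.
(* [q] is the length of the side from B_1 to B_2. Below, [u] and [- v] are differences of their
   first and second coordinates, both strictly between 0 and 1. *)
have q1 : q < 1.
  have d1 : edist (S0 (tip 0)) (S0 (tip 1)) = q.
    rewrite S0q (_ : edist _ _ = 1) ?mulr1//; apply/eqP.
    rewrite -(@eqrXn2 _ 2%N)// ?edist_ge0// expr1n edist_bary sum_ord3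
      !bary_tip.
    by rewrite -!val_eqE/=; apply/eqP; field.
  rewrite -d1 -(@ltr_pXn2r _ 2%N)// ?nnegrE ?edist_ge0// expr1n edist_bary.
  have := bary_sum (S0 (tip 0)); have := bary_sum (S0 (tip 1));
    rewrite !sum_ord3.
  have := Bdiag 0; have := Bdiag 1; have := p_lt1 0 1 isT.
  have := Btri 0 1; have := Btri 0 (1 + 1); have := Btri 1 0;
    have := Btri 1 (1 + 1).
  have := p_gt0 0; have := p_gt0 1.
  move=> ? ? ? ? ? ? ? b1 b0 sum1 sum0.
  set u := bary 0 _ - bary 0 _; set v := bary 1 (S0 (tip 0)) - bary 1 _.
  rewrite (_ : bary (1 + 1) _ - _ = - v - u); last by rewrite /u /v; lra.
  rewrite -(opprK v) sqrrN opprK.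
  by apply: hexagon_lt1; rewrite /u /v; lra.
pose S := oapp F S0; pose Q := oapp p q.
have Sd i x y : edist (S i x) (S i y) = Q i * edist x y by case: i => [a|] /=.
pose r := Num.max (p1 + p2 + p3) q.
have Qr i : 0 < Q i <= r.
  case: i => [a|] /=; first by rewrite p_gt0 le_max p_le.
  by rewrite q0 le_max lexx orbT.
have r1 : r < 1 by rewrite gt_max psum.
have r01 : 0 <= r < 1 by rewrite r1 andbT (le_trans (ltW q0))// le_max lexx
  orbT.
have Sle i x y : edist (S i x) (S i y) <= r * edist x y.
  by rewrite Sd ler_wpM2r ?edist_ge0//; case/andP: (Qr i).
have {}KE : K = \bigcup_i (S i @` K) by rewrite {1}KE tuple4_bigcup.
have SK i z : K z -> K (S i z) by move=> Kz; rewrite KE; exists i => //;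
  exists z.
have clK : closed K by apply: compact_closed => //; exact: plane_hausdorff.
have Ktri : K `<=` triangle.
  apply: (ifs_attract r01 Sle cK) => //; first by rewrite {1}KE.
  - exact: triangle_closed.
  - by exists (tip 0) => b; rewrite bary_tip.
  - by move=> [a|] z; [exact: Ftri|exact: S0tri].
have K'K : K' `<=` K.
  apply: (ifs_attract (S := F) r01 (fun a => Sle (Some a)) cK') => //.
    by rewrite {1}K'E.
  by move=> a; exact: (SK (Some a)).
have tip_fix a : F a (tip a) = tip a.
  by rewrite /F corner_mapE -scalerDl addrC subrK scale1r.
(* The [a]-th coordinate is at least [1 - p a] on the left and at most [p b] on the right. *)
have sep a b x y : a != b -> triangle x -> triangle y -> F a x <> F b y.
  move=> ab tx ty /(congr1 (bary a));
    rewrite !FE eqxx (negbTE ab) mulr1 mulr0 addr0.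
  have := p_lt1 a b ab; have := triangle_le1 a ty; have := tx a.
  by have := p_gt0 a; have := p_gt0 b; nra.
exists Q, r; split => //.
(* The singleton of the fixed point is a compact set covered by its own images. *)
- move=> a; have sub : [set tip a] `<=` K.
    apply: (ifs_attract r01 Sle) => //; first exact: compact_set1.
    by move=> _ ->; exists (Some a) => //; exists (tip a) => //; exact: tip_fix.
  exact: sub.
- by move=> a b x y ab /Ktri tx /Ktri ty; exact: sep.
(* The [a]-th coordinate of [S0 x] averages those of the vertices B_c with weights [bary c x]; it is
   at most [1 - p a], with equality only if all weight is on [a], whereas a point of the corner
   piece has at least [1 - p a]. *)
- move=> a x y /Ktri tx /Ktri ty /(congr1 (bary a)) /=.
  rewrite S0E FE eqxx mulr1 => xy.
  have h c : 0 <= bary c x * (1 - p a - bary a (S0 (tip c))).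
    rewrite mulr_ge0//.
    have [->|ca] := eqVneq c a; first by rewrite Bdiag; lra.
    have := Boff a c; rewrite eq_sym => /(_ ca).
    by have := p_lt1 a c; rewrite eq_sym => /(_ ca); lra.
  have s0 : \sum_c bary c x * (1 - p a - bary a (S0 (tip c))) <= 0.
    under eq_bigr do rewrite mulrBr.
    rewrite sumrB -mulr_suml bary_sum mul1r xy.
    have := mulr_ge0 (ltW (p_gt0 a)) (ty a); lra.
  have z0 c : c != a -> bary c x = 0.
    move=> ca; apply/eqP; have : bary c x * (1 - p a - bary a (S0 (tip c))) ==
      0.
      rewrite eq_le h andbT; apply: le_trans s0.
      by rewrite (bigD1 c)//= lerDl sumr_ge0.
    rewrite mulf_eq0 => /orP[//|]; have := Boff a c; rewrite eq_sym => /(_ ca).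
    by have := p_lt1 a c; rewrite eq_sym => /(_ ca) ? ? /eqP; lra.
  apply: bary_inj => c; rewrite bary_tip; have [->|ca] := eqVneq c a;
    last exact: z0.
  by have := bary_sum x; rewrite (bigD1 a)//= big1 ?addr0.
(* As a point of [K'], B_a lies in some piece of [K'], which by [sep] is the piece [a]. Cancelling
   [F a] and arguing again with [a + 1] puts the second preimage in [K'], hence in [K]. *)
- move=> a; have [K'B [s [ts _ BE]]] := BP a.
  have [k K'k kE] : exists2 k, K' k & S0 (tip a) = F a k.
    have := K'B; rewrite {1}K'E => -[b _ [k K'k kE]]; exists k => //.
    have [ba|ba] := eqVneq b a; first by rewrite -kE ba.
    have := sep b a k (F (a + 1) s) ba (K'tri _ K'k) (Ftri _ _ ts).
    by rewrite -BE => /(_ kE).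
  have kE' : k = F (a + 1) s.
    by apply: (sim_inj (p_gt0 a) (Fd a)); rewrite -kE BE.
  have := K'k; rewrite {1}K'E => -[b _ [z K'z zE]]; exists z; first exact: K'K.
  have [ba|ba] := eqVneq b (a + 1); first by rewrite /= kE -zE ba.
  by have := sep b (a + 1) z s ba (K'tri _ K'z) ts; rewrite -kE' => /(_ zE).
Qed.

End Triangle.

Unset Implicit Arguments.
Set Strict Implicit.

Theorem corollary1 (R : realType) (p1 p2 p3 : R) (B1 B2 B3 : plane R)
    (S0 : plane R -> plane R) (K : set (plane R))
    (O : plane R) (gamma1 : set (plane R)) (s : \bar R)
    (hadm : admissible p1 p2 p3 B1 B2 B3)
    (hS0 : similarity S0)
    (hS0A : [/\ S0 (A1 R) = B1, S0 (A2 R) = B2 & S0 (A3 R) = B3])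
    (hK : is_attractor [tuple S0; S1 p1; S2 p2; S3 p3] K)
    (hO : S0 O = O)
    (hgamma1 : is_arc O (A1 R) gamma1)
    (hgamma1K : gamma1 `<=` K)
    (hs : s = hausdorff_dim gamma1) :
  forall (x y : plane R) (gamma : set (plane R)),
    K x -> K y -> x <> y ->
    is_arc x y gamma -> gamma `<=` K ->
    hausdorff_dim gamma = s.
Proof.
move=> x y gamma _ _ xy hgamma hgammaK; rewrite hs.
have KO : K O by apply: hgamma1K; case: (arc_ends hgamma1).
have [q [r sys]] := admissible_tripod hadm hS0 hS0A hK hO KO.
exact: (hausdorff_dim_arc sys hgamma1 hgamma1K xy hgamma hgammaK).
Qed.
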